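(* $$\int_0^{\infty} e^{-x^2}\ln(x)\,dx = -\frac{\sqrt{\pi}}{4}\left(\gamma+\ln(4)\right).$$
   Context: $\gamma$ is the Euler-Mascheroni constant and $\ln$ is the natural logarithm. *)

(* Defs.v *)
From mathcomp Require Import all_boot all_order all_algebra.
From mathcomp Require Import all_classical all_reals all_analysis.

Set Implicit Arguments.
Unset Strict Implicit.
Unset Printing Implicit Defensive.
Import Order.TTheory GRing.Theory Num.Theory.
Import numFieldNormedType.Exports.
Local Open Scope classical_set_scope.
Local Open Scope ring_scope.

Definition euler_mascheroni_seq (R : realType) (n : nat) : R :=
  \sum_(1 <= k < n.+1) k%:R^-1 - ln n%:R.

Definition euler_mascheroni (R : realType) : R :=
  limn (@euler_mascheroni_seq R).

(* [limn] returns a default value on a divergent sequence, so the definition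
   above is only meaningful together with this fact. *)
Lemma is_cvg_euler_mascheroni_seq (R : realType) :
  cvgn (@euler_mascheroni_seq R).
Proof.
have ratioE n : n.+2%:R = n.+1%:R * (1 + n.+1%:R^-1) :> R.
  by rewrite mulrDr mulr1 divff ?pnatr_eq0// -natr1.
have ratioE' n : n.+1%:R = n.+2%:R * (1 - n.+2%:R^-1) :> R.
  by rewrite mulrBr mulr1 divff ?pnatr_eq0// -[n.+2%:R]natr1 addrK.
have inv_gt0 n : 0 < n.+1%:R^-1 :> R by rewrite invr_gt0 ltr0n.
have inv_lt1 n : n.+2%:R^-1 < 1 :> R by rewrite invf_lt1 ?ltr1n ?ltr0n.
have ln_le n : ln n.+1%:R <= \sum_(1 <= k < n.+1) k%:R^-1 :> R.
  elim: n => [|n IH]; first by rewrite big_geq// ln1.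
  rewrite big_nat_recr//= ratioE lnM ?posrE ?ltr0n ?addr_gt0// lerD//.
  by rewrite le_ln1Dx// (lt_trans _ (inv_gt0 n))// oppr_lt0.
suff : cvgn [sequence @euler_mascheroni_seq R n.+1]_n.
  by case/cvg_ex => l; rewrite cvg_shiftS => ul; apply/cvg_ex; exists l.
apply: nonincreasing_is_cvgn.
  apply/nonincreasing_seqP => n; rewrite /= /euler_mascheroni_seq.
  rewrite [in leLHS]big_nat_recr//= -addrA lerD2l.
  rewrite [in leRHS]ratioE' lnM ?posrE ?ltr0n ?subr_gt0// opprD addrC.
  rewrite lerD2l lerNr le_ln1Dx// ltrN2.
  exact: inv_lt1.
exists 0 => _ [n _ <-]; rewrite /= /euler_mascheroni_seq subr_ge0.
rewrite big_nat_recr//= (le_trans (ln_le n))// lerDl.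
exact/ltW/inv_gt0.
Qed.

(* Main.v *)
Require Import Defs.
From mathcomp Require Import all_boot all_order all_algebra.
From mathcomp Require Import all_classical all_reals all_analysis.
From mathcomp Require Import measurable_realfun ring lra.
Import Order.TTheory GRing.Theory Num.Theory.
Import numFieldNormedType.Exports.
Local Open Scope classical_set_scope.
Local Open Scope ring_scope.

(* By dominated convergence the integral is the limit, as [M] tends to infinity,
   of the integral of [(1 - (x / M) ^ 2) ^ (M ^ 2) * ln x] over [[0, M]]. After
   [x = M y] this involves
   [W_n = \int_0^1 (1 - y ^ 2) ^ n dy] and
   [L_n = \int_0^1 (1 - y ^ 2) ^ n * ln y dy] for [n = M ^ 2], and integration by
   parts yields [L_n = - W_n * \sum_(k <= n) 1 / (2 k + 1)]. The same limit without
   the logarithm shows [M * W_(M ^ 2) --> sqrt pi / 2] (Gauss integral), while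
   [ln M - \sum_(k <= M ^ 2) 1 / (2 k + 1) --> - (gamma + ln 4) / 2] because the
   sum of inverses of odd numbers is [H_(2 n) - H_n / 2]. *)

(** * Primitives of [(1 - y ^ 2) ^ n], with and without the factor [ln y] *)

(* The recursions for the primitives of [(1 - y ^ 2) ^ n] and of
   [(1 - y ^ 2) ^ n * ln y] come from differentiating [y * (1 - y ^ 2) ^ n] and
   [y * ln y * (1 - y ^ 2) ^ n]. As [ln 0 = 0], the second primitive vanishes at
   [0] and is continuous there from the right. *)
Fixpoint wallis_primitive (R : realType) (n : nat) (y : R) : R :=
  if n is n'.+1 then
    (y * (1 - y ^+ 2) ^+ n + 2 * n%:R * wallis_primitive R n' y) / (2 * n%:R + 1)
  else y.

Fixpoint log_wallis_primitive (R : realType) (n : nat) (y : R) : R :=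
  if n is n'.+1 then
    (y * ln y * (1 - y ^+ 2) ^+ n + 2 * n%:R * log_wallis_primitive R n' y
     - wallis_primitive R n y) / (2 * n%:R + 1)
  else y * ln y - y.

Arguments wallis_primitive {R}.
Arguments log_wallis_primitive {R}.

(** Writing [y ^ 2] as [1 - (1 - y ^ 2)] turns the derivative of [y * (1 - y ^ 2) ^ n.+1] into [(k +
    1) * (1 - y ^ 2) ^ n.+1 - k * (1 - y ^ 2) ^ n] with [k = 2 * n.+1]; the last term cancels
    against the induction hypothesis. *)
Lemma is_derive_wallis_primitive (R : realType) n (y : R) :
  is_derive y 1 (wallis_primitive n) ((1 - y ^+ 2) ^+ n).
Proof.
elim: n => [|n IH]; first by rewrite expr0; exact: is_derive_id.
set k : R := 2 * n.+1%:R.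
have k10 : k + 1 != 0 by rewrite gt_eqF// ltr_wpDl// mulr_ge0.
have -> : wallis_primitive n.+1 = (k + 1)^-1 \*:
    (id * (cst 1 - id ^+ 2) ^+ n.+1 + k \*: wallis_primitive n).
  by apply/funext => x /=; rewrite !fctE mulrC.
apply: is_derive_eq; rewrite /GRing.scale /= !fctE /= ![_ ^+ n.+1]exprS -/k.
set u := (1 - _) ^+ n. rewrite /k in k10 *; field.
by rewrite (addrC 1) natr1.
Qed.

Lemma is_derive_log_wallis_primitive (R : realType) n (y : R) : 0 < y ->
  is_derive y 1 (log_wallis_primitive n) ((1 - y ^+ 2) ^+ n * ln y).
Proof.
move=> y0; have dln := is_derive1_ln y0; have yn0 := lt0r_neq0 y0.
elim: n => [|n IH].
  have -> : log_wallis_primitive 0 = id * @ln R - id by [].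
  apply: is_derive_eq; rewrite /GRing.scale /= expr0.
  by field.
have dP := is_derive_wallis_primitive R n.+1 y.
set k : R := 2 * n.+1%:R.
have k10 : k + 1 != 0 by rewrite gt_eqF// ltr_wpDl// mulr_ge0.
have -> : log_wallis_primitive n.+1 = (k + 1)^-1 \*:
    (id * @ln R * (cst 1 - id ^+ 2) ^+ n.+1 + k \*: log_wallis_primitive n
     - wallis_primitive n.+1).
  by apply/funext => x; rewrite /= !fctE mulrC.
apply: is_derive_eq; rewrite /GRing.scale /= !fctE /= ![_ ^+ n.+1]exprS -/k.
set u := (1 - _) ^+ n; rewrite /k in k10 *; field.
by rewrite yn0 (addrC 1) natr1.
Qed.

Lemma wallis_primitive0 (R : realType) n : wallis_primitive n 0 = 0 :> R.
Proof. by elim: n => //= n ->; rewrite mul0r mulr0 addr0 mul0r. Qed.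

(** At [1] the boundary terms vanish. With [k = 2 * n.+1], what remains is
    [W_n.+1 = k * W_n / (k + 1)] and [L_n.+1 = (k * L_n - W_n.+1) / (k + 1)], so each step lowers
    the ratio [L / W] by [1 / (k + 1)]. *)
Lemma log_wallis_primitive1 (R : realType) n :
  log_wallis_primitive n 1
  = - wallis_primitive n 1 * \sum_(k < n.+1) (2 * k%:R + 1)^-1 :> R.
Proof.
elim: n => [|n IH].
  by rewrite big_ord_recr big_ord0 /= ln1; field.
have k10 : 2 * n.+1%:R + 1 != 0 :> R by rewrite gt_eqF// ltr_wpDl// mulr_ge0.
rewrite big_ord_recr /= IH ln1 expr1n subrr expr0n /=.
set s := (\sum_(_ < _) _); field.
by rewrite (addrC 1) natr1.
Qed.

(** * The logarithm near zero *)

Lemma cvg_xlnx (R : realType) : (x : R) * ln x @[x --> 0^'+] --> 0.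
Proof.
apply/cvgr0Pnorm_lt => e e0.
near=> x.
have x0 : 0 < x by near: x; exact: nbhs_right_gt.
have sx0 : 0 < Num.sqrt x by rewrite sqrtr_gt0.
have x1 : x <= 1 by near: x; exact: nbhs_right_le.
have xE : x = Num.sqrt x ^+ 2 by rewrite sqr_sqrtr// ltW.
(* [- ln x = 2 * ln (1 / sqrt x) < 2 / sqrt x] *)
have le2 : `|x * ln x| <= 2 * Num.sqrt x.
  rewrite normrM (ger0_norm (ltW x0)) (ler0_norm (ln_le0 x1)).
  have : ln (Num.sqrt x)^-1 < (Num.sqrt x)^-1 by rewrite ln_sublinear// invr_gt0.
  rewrite lnV ?posrE// [in ln x]xE [X in X * _]xE lnXn// => h.
  have : Num.sqrt x ^+ 2 * - ln (Num.sqrt x) <= Num.sqrt x.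
    rewrite -[leRHS](mulfK (lt0r_neq0 sx0)) -expr2.
    by rewrite ler_wpM2l ?sqr_ge0// ltW.
  by rewrite mulr2n; lra.
apply: le_lt_trans le2 _.
have e20 : 0 < e / 2 by rewrite divr_gt0.
rewrite mulrC -ltr_pdivlMr// -[ltRHS]ger0_norm ?ltW// -sqrtr_sqr ltr_sqrt ?exprn_gt0//.
by near: x; apply: nbhs_right_lt; rewrite exprn_gt0// divr_gt0.
Unshelve. all: by end_near. Qed.

(** Two-sided derivatives on the closed interval supply the one-sided continuity at the endpoints
    required by [continuous_FTC2]. *)
Lemma continuous_derivable_FTC2 (R : realType) (f F : R -> R) (a b : R) : a < b ->
  {in `[a, b], forall x, {for x, continuous f}} ->
  {in `[a, b], forall x : R, is_derive x 1 F (f x)} ->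
  (\int[@lebesgue_measure R]_(x in `[a, b]) (f x)%:E = (F b - F a)%:E)%E.
Proof.
move=> ab cf dF.
have cF x : x \in `[a, b] -> {for x, continuous F}.
  move=> /dF dFx; apply: differentiable_continuous.
  by apply/derivable1_diffP; exact: ex_derive.
have oo_cc x : x \in `]a, b[ -> x \in `[a, b] by exact: subset_itv_oo_cc.
rewrite EFinB; apply: continuous_FTC2 => //.
- by apply: continuous_in_subspaceT => x; rewrite inE => /cf.
- split.
  + by move=> x /oo_cc /dF dFx; exact: ex_derive.
  + by apply: cvg_at_right_filter; apply: cF; rewrite in_itv /= lexx ltW.
  + by apply: cvg_at_left_filter; apply: cF; rewrite in_itv /= lexx ltW.
- by move=> x /oo_cc /dF dFx; rewrite derive1E; exact: derive_val.
Qed.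

(** Monotone convergence along intervals [[a, 1]] with [a] decreasing to [0]: the primitive
    [x - x * ln x] of [- ln x] gives [1 - a + a * ln a], which is at most [1]. *)
Lemma integrable_ln01 (R : realType) :
  (@lebesgue_measure R).-integrable `]0, 1] (EFin \o @ln R).
Proof.
apply/integrableP; split.
  by apply/measurable_EFinP; apply: measurable_funTS; exact: measurable_ln.
(* Starting at [1 / 2] rather than [1] keeps every interval nondegenerate, as the fundamental
   theorem of calculus requires. *)
have -> : `]0%R, 1%R]%classic = \bigcup_k `[(k.+2%:R^-1 : R), 1]%classic.
  apply/seteqP; split => x /=.
    rewrite in_itv /= => /andP[x0 x1].
    exists (Num.truncn x^-1) => //=; rewrite in_itv /= x1 andbT.
    rewrite invf_ple ?posrE//.
    apply: le_trans (ltW (truncnS_gt _)) _.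
    by rewrite ler_nat.
  move=> [k _]; rewrite /= !in_itv /= => /andP[kx ->]; rewrite andbT.
  by apply: lt_le_trans kx; rewrite invr_gt0.
pose F k := `[(k.+2%:R^-1 : R), 1]%classic.
have cvgF : (\int[@lebesgue_measure R]_(x in F k) `|(EFin \o @ln R) x| @[k --> \oo]
   --> \int[@lebesgue_measure R]_(x in \bigcup_k F k) `|(EFin \o @ln R) x|)%E.
  apply: ge0_nondecreasing_set_cvg_integral => //.
  - apply/nondecreasing_seqP => n; apply/subsetPset => x.
    rewrite /F /= !in_itv /= => /andP[nx ->]; rewrite andbT.
    by apply: le_trans nx; rewrite lef_pV2 ?posrE// ler_nat.
  - by move=> i; exact: measurable_itv.
  - move=> i; apply: measurable_funTS; apply: measurableT_comp => //.
    by apply/measurable_EFinP; exact: measurable_ln.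
apply: (@le_lt_trans _ _ 1%E); last exact: ltry.
rewrite -(cvg_lim _ cvgF)//.
apply: lime_le; first by apply/cvg_ex; eexists; exact: cvgF.
apply: nearW => k; rewrite /F /=.
have k0 : 0 < k.+2%:R^-1 :> R by rewrite invr_gt0.
have k1 : k.+2%:R^-1 < 1 :> R by rewrite invf_lt1// ltr1n.
have pos (x : R) : x \in `[k.+2%:R^-1, 1] -> 0 < x.
  by rewrite in_itv /= => /andP[kx _]; exact: lt_le_trans kx.
have -> : (\int[@lebesgue_measure R]_(x in `[k.+2%:R^-1%R, 1%R]) `|ln x|%:E =
    \int[@lebesgue_measure R]_(x in `[k.+2%:R^-1%R, 1%R]) (- ln x)%:E)%E.
  apply: eq_integral => x; rewrite inE /= in_itv /= => /andP[kx x1].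
  by rewrite ler0_norm ?ln_le0.
rewrite (@continuous_derivable_FTC2 _ _ (id - id * @ln R))//.
- rewrite !fctE /= ln1 mulr0 subr0 lee_fin.
  have : k.+2%:R^-1 * ln k.+2%:R^-1 <= 0 :> R.
    by rewrite mulr_ge0_le0 ?(ltW k0) ?ln_le0 ?(ltW k1).
  move: k0; move: (k.+2%:R^-1) => a a0; lra.
- by move=> x /pos x0; apply: cvgN; exact: continuous_ln.
- move=> x /pos x0; have dln := is_derive1_ln x0; have xn0 := lt0r_neq0 x0.
  by apply: is_derive_eq; rewrite /GRing.scale /=; field.
Qed.

(** * Approximation of the Gaussian by powers *)

Lemma bernoulli_inequality (R : realType) (u : R) n : 0 <= u <= 1 ->
  1 - n%:R * u <= (1 - u) ^+ n.
Proof.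
move=> /andP[u0 u1]; elim: n => [|n IH]; first by rewrite mul0r subr0 expr0.
have n0 : 0 <= n%:R :> R by [].
rewrite exprS -natr1.
have : (1 - u) * (1 - n%:R * u) <= (1 - u) * (1 - u) ^+ n.
  by rewrite ler_wpM2l// subr_ge0.
have : 0 <= n%:R * u * u by rewrite !mulr_ge0.
by move: ((1 - u) ^+ n) => b; lra.
Qed.

Lemma onemX_le_expR (R : realType) (t : R) n : t <= 1 ->
  (1 - t) ^+ n <= expR (- (n%:R * t)).
Proof.
move=> t1; rewrite -mulrN expRM_natl lerXn2r ?nnegrE ?expR_ge0 ?subr_ge0//.
exact: expR_ge1Dx.
Qed.

(* From [expR (- t) * (1 + t) <= 1] and Bernoulli's inequality. *)
Lemma onemX_ge_expR (R : realType) (t : R) n : 0 <= t <= 1 ->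
  expR (- (n%:R * t)) * (1 - n%:R * t ^+ 2) <= (1 - t) ^+ n.
Proof.
move=> /andP[t0 t1].
have t21 : 0 <= t ^+ 2 <= 1 by rewrite sqr_ge0 exprn_ile1.
apply: (@le_trans _ _ (expR (- (n%:R * t)) * (1 - t ^+ 2) ^+ n)).
  by rewrite ler_wpM2l ?expR_ge0// bernoulli_inequality.
rewrite -mulrN expRM_natl -exprMn lerXn2r ?nnegrE ?mulr_ge0 ?expR_ge0 ?subr_ge0//.
  by case/andP: t21.
rewrite (_ : 1 - t ^+ 2 = (1 + t) * (1 - t)); last by ring.
rewrite mulrA ler_piMl ?subr_ge0// -[leRHS](expRxMexpNx_1 t) mulrC.
by rewrite ler_wpM2r ?expR_ge0// expR_ge1Dx.
Qed.

(** Squeeze with [t = (x / M) ^ 2], [n = M ^ 2] and [M = m.+1]: [n * t] is exactly [x ^ 2], while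
    the error term [n * t ^ 2 = x ^ 4 / M ^ 2] tends to [0]. *)
Lemma cvg_onemX_gauss (R : realType) (x : R) : 0 <= x ->
  (1 - (x / m.+1%:R) ^+ 2) ^+ (m.+1 ^ 2) @[m --> \oo] --> expR (- x ^+ 2).
Proof.
move=> x0.
apply: (@squeeze_cvgr _ _ _ _
  (fun m : nat => expR (- x ^+ 2) * (1 - x ^+ 4 * harmonic m * harmonic m))
  (fun=> expR (- x ^+ 2))).
- near=> m.
  have xm : x <= m.+1%:R.
    near: m.
    by apply: filterS (nbhs_infty_ger x) => k /le_trans; apply; rewrite ler_nat.
  have t01 : 0 <= (x / m.+1%:R) ^+ 2 <= 1.
    by rewrite sqr_ge0 exprn_ile1 ?divr_ge0// ler_pdivrMr// mul1r.
  have nt : (m.+1 ^ 2)%:R * (x / m.+1%:R) ^+ 2 = x ^+ 2.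
    by rewrite natrX; field.
  have nt2 : (m.+1 ^ 2)%:R * ((x / m.+1%:R) ^+ 2) ^+ 2
      = x ^+ 4 * harmonic m * harmonic m.
    by rewrite natrX /harmonic /=; field.
  have := onemX_ge_expR R _ (m.+1 ^ 2) t01.
  have := onemX_le_expR R _ (m.+1 ^ 2) (andP t01).2.
  by rewrite nt nt2 => -> ->.
- rewrite -[X in _ --> X]mulr1 -[X in _ * X]subr0 -[X in _ - X](mulr0 (x ^+ 4 * 0)).
  apply: cvgM; first exact: cvg_cst.
  apply: cvgB; first exact: cvg_cst.
  apply: cvgM; last exact: cvg_harmonic.
  by apply: cvgM; [exact: cvg_cst|exact: cvg_harmonic].
- exact: cvg_cst.
Unshelve. all: by end_near. Qed.

(** * Integrability and dominated convergence *)

(** This function dominates the Gaussian times [ln x] for [x > 1]; its primitive is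
    [- expR (- x ^ 2) / 2]. *)
Lemma integrable_xgauss (R : realType) :
  (@lebesgue_measure R).-integrable `[0, +oo[
    (EFin \o (fun x => x * expR (- x ^+ 2))).
Proof.
have dF (x : R) : is_derive x 1 (fun x => - 2^-1 * expR (- x ^+ 2)) (x * expR (- x ^+ 2)).
  have -> : (fun x : R => - 2^-1 * expR (- x ^+ 2))
     = - 2^-1 \*: (@expR R \o (- id ^+ 2)) by [].
  have dN : is_derive x 1 (- (@id R) ^+ 2) (- (2 * x)).
    by apply: is_derive_eq; rewrite /GRing.scale /=; ring.
  have dE := is_derive1_comp (is_derive_expR ((- (@id R) ^+ 2) x)) dN.
  by apply: is_derive_eq; rewrite /GRing.scale /=; field.
have cf : continuous (fun x : R => x * expR (- x ^+ 2)).
  move=> x; apply: cvgM; first exact: cvg_id.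
  exact: continuous_gauss_fun.
have cF : continuous (fun x : R => - 2^-1 * expR (- x ^+ 2)).
  move=> x; apply: cvgM; first exact: cvg_cst.
  exact: continuous_gauss_fun.
have mf : measurable_fun (`[0, +oo[ : set R) (EFin \o (fun x : R => x * expR (- x ^+ 2))).
  apply/measurable_EFinP; apply: measurable_funTS.
  exact: continuous_measurable_fun.
apply/integrableP; split => //=.
have -> : (\int[@lebesgue_measure R]_(x in `[0%R, +oo[)
     `|(x * expR (- x ^+ 2))%:E| =
   \int[@lebesgue_measure R]_(x in `[0%R, +oo[) (x * expR (- x ^+ 2))%:E)%E.
  apply: eq_integral => x; rewrite inE /= in_itv /= andbT => x0.
  by rewrite ger0_norm// mulr_ge0// expR_ge0.
rewrite (@ge0_continuous_FTC2y _ _ (fun x => - 2^-1 * expR (- x ^+ 2)) _ 0)//=.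
- by rewrite -EFinB ltry.
- by move=> x x0; rewrite mulr_ge0// expR_ge0.
- exact: continuous_subspaceT.
- rewrite -[X in _ --> X](mulr0 (- 2^-1)).
  by apply: cvgM; [exact: cvg_cst|exact: cvg_gauss_fun].
- by apply: cvg_at_right_filter; exact: cF.
- by move=> x x0; rewrite derive1E; exact: (@derive_val _ _ _ _ _ _ _ (dF x)).
Qed.

(** The majorant is a sum of two terms: the norm of [ln] restricted to []0, 1]], where the Gaussian
    is at most [1], and [x * expR (- x ^ 2)], which suffices beyond [1] because [ln x < x]. *)
Lemma integrable_gauss_ln (R : realType) :
  (@lebesgue_measure R).-integrable `]0, +oo[
    (EFin \o (fun x => expR (- x ^+ 2) * ln x)).
Proof.
have mpos : measurable (`]0, +oo[ : set R) by exact: measurable_itv.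
have i1 : (@lebesgue_measure R).-integrable `]0, +oo[
    (EFin \o (fun x => x * expR (- x ^+ 2))).
  apply: integrableS (integrable_xgauss R) => //.
  by move=> x /=; rewrite !in_itv /= !andbT; exact: ltW.
have i2 : (@lebesgue_measure R).-integrable `]0, +oo[
    (EFin \o (Num.norm \o (@ln R \_ `]0, 1]))).
  apply: integrable_norm; rewrite -restrict_EFin.
  apply/integrable_restrict => //.
  apply: integrableS (integrable_ln01 R) => //; exact: measurableI.
apply: le_integrable (integrableD _ i1 i2) => //.
  apply/measurable_EFinP; apply: measurable_funTS; apply: measurable_funM.
    exact: measurable_gauss_fun.
  exact: measurable_ln.
move=> x /=; rewrite in_itv /= andbT => x0.
rewrite lee_fin normrM (ger0_norm (expR_ge0 _)).
rewrite [leRHS]ger0_norm ?addr_ge0 ?mulr_ge0 ?expR_ge0 ?(ltW x0)//.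
have [x1|x1] := leP x 1.
  rewrite patchT; last by rewrite inE /= in_itv /= x0.
  rewrite ler_wpDl ?mulr_ge0 ?expR_ge0 ?(ltW x0)//.
  by rewrite ler_piMl// -expR0 ler_expR oppr_le0 sqr_ge0.
rewrite ler_wpDr// mulrC ler_wpM2r ?expR_ge0//.
by rewrite ger0_norm ?ln_ge0 ?(ltW x1)// ltW// ln_sublinear.
Qed.

(** The integrands are extended by [0] outside [[a m, m.+1]]. Each [x > 0] eventually lies in this
    interval since [a] tends to [0], and [onemX_le_expR] makes the limit function itself, in
    absolute value, a majorant. The factor [h] will be [1] and then [ln]. *)
Lemma cvg_integral_onemX_gauss (R : realType) (h : R -> R) (a : nat -> R) :
  measurable_fun setT h ->
  (@lebesgue_measure R).-integrable `]0, +oo[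
    (EFin \o (fun x => expR (- x ^+ 2) * h x)) ->
  (forall m, 0 < a m) -> a @ \oo --> 0 ->
  (\int[@lebesgue_measure R]_(x in `[a m, m.+1%:R])
     ((1 - (x / m.+1%:R) ^+ 2) ^+ (m.+1 ^ 2) * h x)%:E @[m --> \oo] -->
   \int[@lebesgue_measure R]_(x in `]0%R, +oo[) (expR (- x ^+ 2) * h x)%:E)%E.
Proof.
move=> mh ih a0 cvga.
pose K m (x : R) := (1 - (x / m.+1%:R) ^+ 2) ^+ (m.+1 ^ 2).
pose A m : set R := [set` `[a m, m.+1%:R]].
pose g m := EFin \o ((fun x => K m x * h x) \_ (A m)).
have mpos : measurable (`]0, +oo[ : set R) by exact: measurable_itv.
have mA m : measurable (A m) by exact: measurable_itv.
have Apos m : A m `<=` `]0, +oo[.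
  by move=> x; rewrite /A /= !in_itv /= andbT => /andP[/(lt_le_trans (a0 m))].
have mK m : measurable_fun setT (K m).
  apply: measurable_funX; apply: measurable_funB => //.
  by apply: measurable_funX; apply: measurable_funM.
have intE m : (\int[@lebesgue_measure R]_(x in A m) (K m x * h x)%:E =
    \int[@lebesgue_measure R]_(x in `]0%R, +oo[) g m x)%E.
  rewrite -[in LHS](setIidr (Apos m)) integral_mkcondr.
  by apply: eq_integral => x _; rewrite /g /= restrict_EFin.
rewrite (_ : (fun m => _) =
    (fun m => \int[@lebesgue_measure R]_(x in `]0%R, +oo[) g m x)%E);
  last by apply/funext => m; exact: intE.
have [|||||_ _ //] := @dominated_convergence _ _ R lebesgue_measure _ mpos g
  (EFin \o (fun x => expR (- x ^+ 2) * h x))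
  (abse \o (EFin \o (fun x => expR (- x ^+ 2) * h x))).
- move=> m; apply/measurable_EFinP.
  apply/measurable_restrict => //; first exact: mA.
  apply: measurable_funTS; apply: measurable_funM => //; exact: mK.
- by case/integrableP : ih.
- apply: aeW => x; rewrite /= in_itv /= andbT => x0.
  apply: cvg_EFin; first exact: nearW.
  have : K m x * h x @[m --> \oo] --> expR (- x ^+ 2) * h x.
    by apply: cvgM; [exact/cvg_onemX_gauss/ltW|exact: cvg_cst].
  apply: cvg_trans; apply: near_eq_cvg; near=> m.
  rewrite /= patchT// inE /A /= in_itv /=; apply/andP; split.
    by near: m; apply: cvgr_le cvga x x0.
  by near: m; apply: filterS (nbhs_infty_ger x) => k /le_trans; apply; rewrite ler_nat.
- exact: integrable_abse.
- apply: aeW => x m; rewrite /= in_itv /= andbT => x0.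
  rewrite lee_fin patchE; case: ifPn => [|_]; last by rewrite normr0.
  rewrite inE /A /= in_itv /= => /andP[_ xm].
  have t1 : (x / m.+1%:R) ^+ 2 <= 1.
    by rewrite exprn_ile1 ?divr_ge0 ?(ltW x0)// ler_pdivrMr// mul1r.
  rewrite !normrM ler_wpM2r// ger0_norm ?exprn_ge0 ?subr_ge0// (ger0_norm (expR_ge0 _)).
  have := onemX_le_expR R _ (m.+1 ^ 2) t1.
  by rewrite [X in expR (- X)](_ : _ = x ^+ 2)// natrX; field.
Unshelve. all: by end_near. Qed.

(** * Sums of inverses of odd numbers and the Euler-Mascheroni constant *)

Lemma sum_inv_odd (R : realType) n :
  \sum_(k < n) (2 * k%:R + 1)^-1 =
  \sum_(1 <= k < (2 * n).+1) k%:R^-1 - 2^-1 * \sum_(1 <= k < n.+1) k%:R^-1 :> R.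
Proof.
elim: n => [|n IH]; first by rewrite big_ord0 muln0 !big_geq// mulr0 subr0.
rewrite big_ord_recr /= IH mulnS add2n.
rewrite [in RHS](big_nat_recr (2 * n).+2)//= (big_nat_recr (2 * n).+1)//=.
rewrite [in RHS](big_nat_recr n.+1)//=.
have -> : (2 * n).+2%:R = 2 * n.+1%:R :> R by rewrite -natrM mulnS.
have -> : (2 * n).+1%:R = 2 * n%:R + 1 :> R by rewrite -natr1 natrM.
rewrite invfM mulrDr.
by move: (\sum_(1 <= k < (2 * n).+1) _) (\sum_(1 <= k < n.+1) _) (_^-1) (_ * _^-1)
  => *; ring.
Qed.

Lemma cvg_nat_ge (f : nat -> nat) : (forall n, (n <= f n)%N) -> f @ \oo --> \oo.
Proof.
move=> nf A [N _ NA]; exists N => // n /= Nn; apply: NA => /=.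
exact: leq_trans (nf n).
Qed.

(** With [M = m.+1] and [N = M ^ 2 + 1] terms, the sum is [H_(2 N) - H_N / 2]. Replacing each [H_j]
    by [e j + ln j] leaves the logarithms [- ln 2 - (ln N - 2 * ln M) / 2], whose last part tends to
    [0]. *)
Lemma cvg_ln_sub_sum_inv_odd (R : realType) :
  ln m.+1%:R - \sum_(k < (m.+1 ^ 2).+1) (2 * k%:R + 1)^-1 @[m --> \oo] -->
  - (2^-1 * (euler_mascheroni R + ln 4)).
Proof.
pose e := euler_mascheroni_seq R.
pose N m := (m.+1 ^ 2).+1.
have ge_N m : (m <= N m)%N by rewrite ltnW// ltnW// ltnS -mulnn leq_pmulr.
have cvge f : (forall m, (m <= f m)%N) -> e (f m) @[m --> \oo] --> euler_mascheroni R.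
  move=> /cvg_nat_ge ff.
  by apply: (cvg_comp f e) ff _; exact: is_cvg_euler_mascheroni_seq.
(* As [harmonic m] is [1 / m.+1], the argument of [ln] is [N m / m.+1 ^ 2]. *)
have cvgln : ln (1 + harmonic m * harmonic m) @[m --> \oo] --> (0 : R).
  rewrite -[X in _ --> X](@ln1 R).
  apply: continuous_cvg; first exact: continuous_ln.
  rewrite -[X in _ --> X]addr0 -[X in _ + X](mulr0 0).
  apply: cvgD; first exact: cvg_cst.
  by apply: cvgM; exact: cvg_harmonic.
have E m : ln m.+1%:R - \sum_(k < N m) (2 * k%:R + 1)^-1 =
    - e (2 * N m)%N + 2^-1 * e (N m) - ln 2
    - 2^-1 * ln (1 + harmonic m * harmonic m) :> R.
  have M0 : 0 < m.+1%:R :> R by [].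
  have -> : 1 + harmonic m * harmonic m = (N m)%:R / m.+1%:R ^+ 2 :> R.
    by rewrite /N -natr1 natrX /harmonic /=; field.
  rewrite ln_div ?posrE ?exprn_gt0// lnXn// sum_inv_odd /e /euler_mascheroni_seq.
  rewrite natrM lnM ?posrE//.
  move: (\sum_(1 <= k < (2 * N m).+1) _) (\sum_(1 <= k < (N m).+1) _) => x y.
  by field.
have -> : - (2^-1 * (euler_mascheroni R + ln 4)) =
    - euler_mascheroni R + 2^-1 * euler_mascheroni R - ln 2 - 2^-1 * 0.
  rewrite (_ : 4 = 2 ^+ 2 :> R); last by ring.
  by rewrite lnXn// ; field.
rewrite (_ : (fun m => _) = fun m => - e (2 * N m)%N + 2^-1 * e (N m) - ln 2
    - 2^-1 * ln (1 + harmonic m * harmonic m)); last by apply/funext => m; exact: E.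
apply: cvgB; last by apply: cvgM => //; exact: cvg_cst.
apply: cvgB; last exact: cvg_cst.
apply: cvgD.
  by apply: cvgN; apply: cvge => m; exact: leq_trans (ge_N m) (leq_pmull _ _).
by apply: cvgM; [exact: cvg_cst|exact: cvge].
Qed.

(** * Rescaling, and integration from a small cutoff *)

Lemma cvg_wallis_primitive0 (R : realType) n :
  wallis_primitive n (y : R) @[y --> 0^'+] --> 0.
Proof.
rewrite -[X in _ --> X](wallis_primitive0 R n).
apply: cvg_at_right_filter; apply: differentiable_continuous.
apply/derivable1_diffP.
exact: (@ex_derive _ _ _ _ _ _ _ (is_derive_wallis_primitive R n 0)).
Qed.

Lemma cvg_log_wallis_primitive0 (R : realType) n :
  log_wallis_primitive n (y : R) @[y --> 0^'+] --> 0.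
Proof.
elim: n => [|n IH].
  rewrite -[X in _ --> X](subr0 0); apply: cvgB; first exact: cvg_xlnx.
  by apply: cvg_at_right_filter; exact: cvg_id.
pose f y : R := (1 - y ^+ 2) ^+ n.+1.
have cvgX : f y @[y --> 0^'+] --> f 0.
  apply: cvg_at_right_filter; apply: differentiable_continuous.
  apply/derivable1_diffP.
  have -> : f = (cst 1 - id ^+ 2) ^+ n.+1 by apply/funext => y; rewrite !fctE.
  exact: ex_derive.
rewrite [X in _ --> X](_ : _ = (0 * f 0 + 2 * n.+1%:R * 0 - 0) / (2 * n.+1%:R + 1));
  last by rewrite !(mul0r, mulr0, addr0, subr0).
apply: cvgM; last exact: cvg_cst.
apply: cvgB; last exact: cvg_wallis_primitive0.
apply: cvgD; first by apply: cvgM => //; exact: cvg_xlnx.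
by apply: cvgM => //; exact: cvg_cst.
Qed.

(** The substitution [x = M * y] is carried out on primitives: [M * H (x / M)] differentiates to the
    integrand, since [h (M * y)] becomes [h x]. *)
Lemma integral_onemX_gauss (R : realType) (h H : R -> R) n (M a : R) :
  0 < a -> a < M ->
  (forall x, 0 < x -> {for x, continuous h}) ->
  (forall y : R, 0 < y -> is_derive y 1 H ((1 - y ^+ 2) ^+ n * h (M * y))) ->
  (\int[@lebesgue_measure R]_(x in `[a, M]) ((1 - (x / M) ^+ 2) ^+ n * h x)%:E =
   (M * H 1 - M * H (a / M))%:E)%E.
Proof.
move=> a0 aM ch dH.
have M0 : 0 < M by exact: lt_trans aM.
have Mn0 := lt0r_neq0 M0.
have pos x : x \in `[a, M] -> 0 < x.
  by rewrite in_itv /= => /andP[ax _]; exact: lt_le_trans ax.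
rewrite (@continuous_derivable_FTC2 _ _ (fun x => M * H (x / M)))//.
- by rewrite divff.
- move=> x /pos x0; apply: cvgM; last exact: ch.
  pose f x : R := (1 - (x / M) ^+ 2) ^+ n.
  suff : {for x, continuous f} by [].
  apply: differentiable_continuous; apply/derivable1_diffP.
  have -> : f = (cst 1 - (id * cst M^-1) ^+ 2) ^+ n by apply/funext => y; rewrite !fctE.
  exact: ex_derive.
- move=> x /pos x0.
  have dM : is_derive x 1 (id * cst M^-1) M^-1.
    by apply: is_derive_eq; rewrite /GRing.scale /=; ring.
  have xM0 : 0 < (id * cst M^-1) x by rewrite fctE divr_gt0.
  have dc := is_derive1_comp (dH _ xM0) dM.
  have -> : (fun x => M * H (x / M)) = M \*: (H \o (id * cst M^-1)).
    by apply/funext => y; rewrite /= !fctE.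
  apply: is_derive_eq; rewrite /GRing.scale /= !fctE /= [M * (x / M)]mulrC divfK//.
  by rewrite mulrCA divff// mulr1.
Qed.

(* Integrating only from a cutoff [a m > 0] at which the primitive is negligible
   avoids improper integrals at the singularity of [ln]. *)
Lemma small_cutoff (R : realType) (F G : nat -> R -> R) :
  (forall m, F m y @[y --> 0^'+] --> 0) ->
  (forall m, G m y @[y --> 0^'+] --> 0) ->
  exists a : nat -> R, [/\ forall m, 0 < a m < harmonic m,
    forall m, `|F m (a m)| < harmonic m & forall m, `|G m (a m)| < harmonic m].
Proof.
move=> F0 G0.
have ex m : exists a, [/\ 0 < a < harmonic m,
    `|F m a| < harmonic m & `|G m a| < harmonic m].
  have h0 : 0 < harmonic m :> R by rewrite /harmonic /= invr_gt0.
  apply: (@filter_ex _ (0 : R)^'+).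
  near=> a; split.
  - by apply/andP; split; near: a; [exact: nbhs_right_gt|exact: nbhs_right_lt].
  - by near: a; move/cvgr0Pnorm_lt : (F0 m); exact.
  - by near: a; move/cvgr0Pnorm_lt : (G0 m); exact.
have [a aP] := choice ex.
by exists a; split => m; have [] := aP m.
Unshelve. all: by end_near. Qed.

Lemma cvg_norm_lt_harmonic (R : realType) (u : nat -> R) :
  (forall m, `|u m| < harmonic m) -> u @ \oo --> 0.
Proof.
move=> uh; apply/norm_cvg0P; apply: (@squeeze_cvgr _ _ _ _ (fun=> 0) (@harmonic R)).
- by apply: nearW => m; rewrite normr_ge0 ltW.
- exact: cvg_cst.
- exact: cvg_harmonic.
Qed.

(** Dominated convergence gives the limit of the integral from the cutoff, that is, of
    [M * H 1 - M * H (a / M)]; the subtracted term tends to [0] by the choice of [a]. It thus links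
    the values of the primitives at [1] to the improper integral. *)
Lemma cvg_scaled_primitive (R : realType) (h : R -> R) (H : nat -> R -> R)
    (a : nat -> R) :
  measurable_fun setT h ->
  (forall x, 0 < x -> {for x, continuous h}) ->
  (@lebesgue_measure R).-integrable `]0, +oo[
    (EFin \o (fun x => expR (- x ^+ 2) * h x)) ->
  (forall m (y : R), 0 < y ->
    is_derive y 1 (H m) ((1 - y ^+ 2) ^+ (m.+1 ^ 2) * h (m.+1%:R * y))) ->
  (forall m, 0 < a m < harmonic m) ->
  (forall m, `|m.+1%:R * H m (a m / m.+1%:R)| < harmonic m) ->
  m.+1%:R * H m 1 @[m --> \oo] -->
    fine (\int[@lebesgue_measure R]_(x in `]0%R, +oo[) (expR (- x ^+ 2) * h x)%:E)%E.
Proof.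
move=> mh ch ih dH ah aH.
have a0 m : 0 < a m by have /andP[] := ah m.
have aM m : a m < m.+1%:R.
  have /andP[_ /lt_le_trans] := ah m; apply; rewrite /harmonic /=.
  by rewrite (@le_trans _ _ 1) ?invf_le1 ?ler1n.
have cvga : a @ \oo --> 0.
  by apply: cvg_norm_lt_harmonic => m; have /andP[? ?] := ah m; rewrite gtr0_norm.
have := @cvg_integral_onemX_gauss R h a mh ih a0 cvga.
rewrite -[X in _ --> X]fineK; last exact: (integrable_fin_num _ ih).
move=> /fine_cvg cvgI.
have : m.+1%:R * H m 1 - m.+1%:R * H m (a m / m.+1%:R) @[m --> \oo] -->
    fine (\int[@lebesgue_measure R]_(x in `]0%R, +oo[) (expR (- x ^+ 2) * h x)%:E)%E.
  apply: cvg_trans cvgI; apply: near_eq_cvg; apply: nearW => m /=.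
  by rewrite (@integral_onemX_gauss _ _ (H m)).
move=> /cvgD /(_ (cvg_norm_lt_harmonic _ _ aH)).
rewrite addr0; apply: cvg_trans; apply: near_eq_cvg; apply: nearW => m /=.
by rewrite subrK.
Qed.

Lemma cvg_at_right0_scale (R : realType) (f : R -> R) (M : R) : 0 < M ->
  f y @[y --> 0^'+] --> 0 -> M * f (y / M) @[y --> 0^'+] --> 0.
Proof.
move=> M0 f0; rewrite -[X in _ --> X](mulr0 M).
apply: cvgM; first exact: cvg_cst.
apply/cvgr0Pnorm_lt => e e0.
have /cvgr0Pnorm_lt/(_ e e0)[d /= d0 fd] := f0.
near=> y.
have y0 : 0 < y by near: y; exact: nbhs_right_gt.
apply: fd => /=; last by rewrite divr_gt0.
rewrite sub0r normrN gtr0_norm ?divr_gt0// ltr_pdivrMr//.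
by near: y; apply: nbhs_right_lt; rewrite mulr_gt0.
Unshelve. all: by end_near. Qed.

Theorem theorem4p2 (R : realType) :
  (\int[@lebesgue_measure R]_(x in `]0%R, +oo[) (expR (- x ^+ 2) * ln x)%:E =
   (- (Num.sqrt pi / 4) * (euler_mascheroni R + ln 4))%:E)%E.
Proof.
pose M m : R := m.+1%:R.
pose n m := (m.+1 ^ 2)%N.
pose P m := @wallis_primitive R (n m).
(* Since [ln (M * y) = ln y + ln M], this is a primitive of [(1 - y ^ 2) ^ n * ln (M * y)], the
   rescaled integrand for [h = ln]. *)
pose Q m (y : R) := log_wallis_primitive (n m) y + ln (M m) * P m y.
have M0 m : 0 < M m by [].
have cvgP0 m : P m y @[y --> 0^'+] --> 0 by exact: cvg_wallis_primitive0.
have cvgQ0 m : Q m y @[y --> 0^'+] --> 0.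
  rewrite [X in _ --> X](_ : _ = 0 + ln (M m) * 0); last by rewrite mulr0 addr0.
  apply: cvgD; first exact: cvg_log_wallis_primitive0.
  by apply: cvgM => //; exact: cvg_cst.
have dP m (y : R) : is_derive y 1 (P m) ((1 - y ^+ 2) ^+ n m).
  exact: is_derive_wallis_primitive.
have dQ m (y : R) : 0 < y ->
    is_derive y 1 (Q m) ((1 - y ^+ 2) ^+ n m * ln (M m * y)).
  move=> y0; have dL := is_derive_log_wallis_primitive R (n m) y y0.
  have -> : Q m = log_wallis_primitive (n m) + ln (M m) \*: P m by [].
  by apply: is_derive_eq; rewrite /GRing.scale /= lnM ?posrE//; ring.
(* A single cutoff sequence serves both families. *)
have [a [a0 aP aQ]] := @small_cutoff R (fun m y => M m * P m (y / M m))
  (fun m y => M m * Q m (y / M m))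
  (fun m => @cvg_at_right0_scale _ _ _ (M0 m) (cvgP0 m))
  (fun m => @cvg_at_right0_scale _ _ _ (M0 m) (cvgQ0 m)).
have igauss : (@lebesgue_measure R).-integrable `]0, +oo[
    (EFin \o (fun x => expR (- x ^+ 2) * cst 1 x)).
  rewrite (_ : _ \o _ = EFin \o gauss_fun); last first.
    by apply/funext => x; rewrite /= mulr1.
  by apply: integrableS (@integrableT_gauss R).
(* The case [h = 1] turns the known Gauss integral into the asymptotics of the Wallis integrals. *)
have cvgP : M m * P m 1 @[m --> \oo] --> Num.sqrt pi / 2.
  have := @cvg_scaled_primitive R (cst 1) P a (measurable_cst _) _ igauss _ a0 aP.
  rewrite (_ : \int[_]_(_ in _) _ = (Num.sqrt pi / 2)%:E)%E; last first.
    rewrite -integral0y_gauss -[RHS]integral_itv_obnd_cbnd.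
      by apply: eq_integral => x _; rewrite mulr1.
    by apply/measurable_EFinP; apply: measurable_funTS; exact: measurable_gauss_fun.
  apply.
  - by move=> x _; exact: cvg_cst.
  - by move=> m y _; rewrite mulr1.
have iln := @integrable_gauss_ln R.
have cvgQ := @cvg_scaled_primitive R (@ln R) Q a (@measurable_ln R)
  (@continuous_ln R) iln dQ a0 aQ.
rewrite -[LHS]fineK; last exact: (integrable_fin_num _ iln).
congr EFin; apply: (cvg_unique _ cvgQ) => //=.
(* By [log_wallis_primitive1], [P m 1] factors out of [Q m 1], so the sequence is a product of two
   sequences with known limits; uniqueness of the limit identifies the integral. *)
rewrite (_ : (fun m => _) = fun m => M m * P m 1 *
    (ln m.+1%:R - \sum_(k < (m.+1 ^ 2).+1) (2 * k%:R + 1)^-1)); last first.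
  by apply/funext => m; rewrite /Q log_wallis_primitive1 /P /M /n; ring.
rewrite [X in _ --> X](_ : _ = Num.sqrt pi / 2 * - (2^-1 * (euler_mascheroni R + ln 4)));
  last by field.
by apply: cvgM => //; exact: cvg_ln_sub_sum_inv_odd.
Qed.
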